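(* Let $\star$ be a nontrivial semistar operation of an integral domain $D$. Then $\mathrm{Max}(\mathrm{Na}(D,\star)) = \{QD_Q(X) \cap \mathrm{Na}(D,\star) \mid Q \in \mathcal{M}(\star_f)\}$.
   Context: $D$ is an integral domain with quotient field $K$. $\overline{\boldsymbol{F}}(D)$ is the set of nonzero $D$-submodules of $K$, and $\boldsymbol{f}(D)$ the set of nonzero finitely generated $D$-submodules of $K$. A semistar operation of $D$ is a map $\star : \overline{\boldsymbol{F}}(D) \to \overline{\boldsymbol{F}}(D)$, $E \mapsto E^\star$, such that for all $0 \neq z \in K$ and all $E, F \in \overline{\boldsymbol{F}}(D)$: $(zE)^\star = zE^\star$; $E \subseteq F \Rightarrow E^\star \subseteq F^\star$; $E \subseteq E^\star$ and $(E^\star)^\star = E^\star$. It is trivial if $E^\star = K$ for all $E$ (equivalently $D^\star = K$), and nontrivial otherwise. $E^{\star_f} := \bigcup\{F^\star \mid F \subseteq E,\ F \in \boldsymbol{f}(D)\}$. A quasi-$\star_f$-ideal of $D$ is a nonzero ideal $I \subseteq D$ with $I^{\star_f} \cap D = I$; $\mathcal{M}(\star_f)$ denotes the set of maximal elements of the set of all proper quasi-$\star_f$-ideals of $D$ (these are prime ideals). $\boldsymbol{c}(h)$ is the ideal generated by the coefficients of a polynomial $h$. $\mathrm{Na}(D,\star) := \{f/g \mid f,g \in D[X],\ g \neq 0,\ \boldsymbol{c}(g)^\star = D^\star\} \subseteq K(X)$. $D_Q(X) := \{f/g \mid f,g \in D_Q[X],\ \boldsymbol{c}(g) = D_Q\}$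 is the Nagata ring of $D_Q$, and $QD_Q(X)$ is the ideal of $D_Q(X)$ generated by $Q$. *)

(* Defs.v *)
From mathcomp Require Import all_boot all_algebra.
From mathcomp Require Import classical_sets.

Set Implicit Arguments.
Unset Strict Implicit.
Unset Printing Implicit Defensive.

Import GRing.Theory.
Local Open Scope classical_set_scope.
Local Open Scope ring_scope.

(** Every ring occurring below is a subring of [K := {fraction D}] or of
    [K(X) := {fraction {poly K}}], and is represented by its underlying set;
    in particular [D] is identified with its image [base_ring D] in [K]. *)

Section Submodules.
Variable T : comNzRingType.
Implicit Types A E I : set T.

(** [A] is meant to be (the underlying set of) a subring of [T], so that
    closure under opposites follows from [-1] being in [A]. *)
Definition submodule A E : Prop :=
  [/\ E 0,
      forall x y, E x -> E y -> E (x + y) &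
      forall a x, A a -> E x -> E (a * x)].

Definition span A (S : set T) : set T := smallest (submodule A) S.

Definition nonzero_submodule A E : Prop := submodule A E /\ E <> [set 0].

Definition nonzero_fg_submodule A E : Prop :=
  nonzero_submodule A E /\ exists s : seq T, E = span A [set` s].

Definition scale_set (z : T) E : set T := [set z * x | x in E].

Definition ideal A I : Prop := I `<=` A /\ submodule A I.

Definition maximal_elements (C : set (set T)) : set (set T) :=
  [set M | C M /\ forall N, C N -> M `<=` N -> N = M].

Definition Max A : set (set T) :=
  maximal_elements [set I | ideal A I /\ I <> A].

Definition poly_over A : set {poly T} := [set p | forall i, A p`_i].

(** For [p] in [A[X]], the ideal of [A] generated by the coefficients of [p]. *)
Definition content A (p : {poly T}) : set T := span A [set` (p : seq T)].

End Submodules.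

Section Semistar.
Variable D : idomainType.

Local Notation K := {fraction D}.
Local Notation KX := {fraction {poly {fraction D}}}.

Definition base_ring : set K := range (@tofrac D).

Definition polyfrac (f g : {poly K}) : KX := tofrac f / tofrac g.

Definition constKX (x : K) : KX := tofrac x%:P.

Definition Fbar : set (set K) := [set E | nonzero_submodule base_ring E].

Definition fgD : set (set K) := [set F | nonzero_fg_submodule base_ring F].

(** A semistar operation is a map [Fbar -> Fbar]; it is represented by a map on
    all subsets of [K] whose values outside [Fbar] are irrelevant. *)
Record semistar_operation (star : set K -> set K) : Prop := {
  semistar_Fbar : forall E, Fbar E -> Fbar (star E);
  semistar_scale : forall z E, z != 0 -> Fbar E ->
    star (scale_set z E) = scale_set z (star E);
  semistar_mono : forall E F, Fbar E -> Fbar F ->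
    E `<=` F -> star E `<=` star F;
  semistar_ext : forall E, Fbar E -> E `<=` star E;
  semistar_idem : forall E, Fbar E -> star (star E) = star E
}.

Definition trivial_semistar (star : set K -> set K) : Prop :=
  forall E, Fbar E -> star E = [set: K].

Section FixedOperation.
Variable star : set K -> set K.

Definition star_f (E : set K) : set K :=
  \bigcup_(F in [set F | fgD F /\ F `<=` E]) star F.

Definition quasi_star_f_ideal (I : set K) : Prop :=
  [/\ ideal base_ring I, I <> [set 0] & star_f I `&` base_ring = I].

Definition Mstar_f : set (set K) :=
  maximal_elements [set I | quasi_star_f_ideal I /\ I <> base_ring].

Definition Na : set KX :=
  [set r | exists f g : {poly K},
    [/\ poly_over base_ring f, poly_over base_ring g, g != 0,
        star (content base_ring g) = star base_ring & r = polyfrac f g]].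

End FixedOperation.

Definition localization (Q : set K) : set K :=
  [set x | exists a s, [/\ base_ring a, base_ring s, ~ Q s & x = a / s]].

(** [c(g) = A] already forces [g != 0] when [A] is a nonzero ring. *)
Definition Nagata (A : set K) : set KX :=
  [set r | exists f g : {poly K},
    [/\ poly_over A f, poly_over A g, content A g = A & r = polyfrac f g]].

Definition extension_to_Nagata (Q : set K) : set KX :=
  span (Nagata (localization Q)) (constKX @` Q).

End Semistar.

(* Main.v *)
From mathcomp Require Import all_boot all_algebra.
From mathcomp Require Import boolp classical_sets.
Require Import Defs.

Set Implicit Arguments.
Unset Strict Implicit.
Unset Printing Implicit Defensive.

Import GRing.Theory.
Local Open Scope classical_set_scope.
Local Open Scope ring_scope.

(** Write [B] for the copy of the domain [D] in its quotient field, and call a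
    polynomial [g] over [B] star-primitive when [1] lies in
    [star_f (content B g)]; [Na star] is the ring of fractions of [B[X]] at the
    set [N] of star-primitive polynomials ([NaE]).

    The first ingredient is a Krull-type existence result, [Mstar_f_above]:
    a nonzero ideal [I] with [~ star_f I 1] lies in some member of
    [Mstar_f star].  It is Zorn's lemma, available because [star_f] only sees
    finitely generated submodules.  From it follow the primality of the members
    of [Mstar_f star], and the equality of [N] with the complement in [B[X]] of
    the union of the [Q[X]], [Q] in [Mstar_f star]
    ([star_primitive_avoids]).  In particular [N] is multiplicative without any
    Dedekind-Mertens argument: each [Q[X]] is prime, by Gauss's lemma.
    Nontriviality of [star] says exactly that [Mstar_f star] is nonempty.

    The second ingredient is a description of the ideals in the statement.
    Both [D_Q(X)] and [Q D_Q(X)] are sets of fractions with denominators in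
    [B[X] \ Q[X]], the numerators being in [B[X]] and in [Q[X]] respectively.
    As [N] avoids the prime [Q[X]], a fraction [f / g] with [g] in [N] is in
    [Q D_Q(X)] if and only if [f] is in [Q[X]] ([trace_mem]).  Write [P_Q]
    for the trace of [Q D_Q(X)] on [Na star].

    The heart is [proper_ideal_sub_trace]: every proper ideal [J] of [Na star]
    lies in some [P_Q].  Let [I] be the union of the contents of the
    polynomials in [J].  If [h] and [k] are in [J], so is [h + X^m k], and for
    [m] at least [size h] its content contains those of [h] and [k]; so the
    union is directed.  Hence [star_f I 1] would be witnessed by a single polynomial of
    [J], which would be star-primitive, hence a unit of [Na star].
    So [I] lies in some [Q], and then [J] lies in [P_Q].

    Finally each [P_Q] is a proper ideal, and an inclusion of [P_Q] in [P_Q']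
    forces one of [Q] in [Q'], hence [Q = Q'] by maximality.  The maximal ideals
    are therefore the [P_Q]. *)

(** * Submodules of a ring over a subset of scalars, and contents *)

Section SubmodulesOfSubrings.
Variables (T : comNzRingType) (A : set T).
Implicit Types (E Q S : set T) (p q f g : {poly T}).

Lemma span_submodule S : submodule A (span A S).
Proof.
split=> [E [[]] //|x y Ex Ey E HE|a x Aa Ex E HE].
  by case: (HE) => -[_ ED _] _; apply: ED; [apply: Ex | apply: Ey].
by case: (HE) => -[_ _ EM] _; apply: EM => //; apply: Ex.
Qed.

Lemma sub_span S : S `<=` span A S. Proof. exact: sub_gen_smallest. Qed.

Lemma span_sub S E : submodule A E -> S `<=` E -> span A S `<=` E.
Proof. exact: smallest_sub. Qed.

Lemma submodule_sum E : submodule A E ->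
  forall I (r : seq I) (P : pred I) (F : I -> T),
  (forall i, P i -> E (F i)) -> E (\sum_(i <- r | P i) F i).
Proof. by case=> E0 ED _ I r P F EF; elim/big_ind: _. Qed.

Lemma poly_over_submodule E :
  submodule A E -> submodule (poly_over A) (poly_over E).
Proof.
move=> HE; case: (HE) => E0 ED EM; split=> [i|f g Ef Eg i|f g Af Eg i].
- by rewrite coef0.
- by rewrite coefD; apply: ED.
- by rewrite coefM; apply: submodule_sum => // j _; apply: EM.
Qed.

Lemma poly_overC E x : E 0 -> E x -> poly_over E x%:P.
Proof. by move=> E0 Ex i; rewrite coefC; case: eqP. Qed.

Lemma poly_overXn E n : E 0 -> E 1 -> poly_over E 'X^n.
Proof. by move=> E0 E1 i; rewrite coefXn; case: eqP. Qed.

Lemma poly_over_coefs E p :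
  E 0 -> poly_over E p <-> [set` (p : seq T)] `<=` E.
Proof.
move=> E0; split=> [Ep x /= /(nthP 0)[i _ <-] //|pE i].
have [lt_ip|/(nth_default 0) ->] // := ltnP i (size p).
exact/pE/mem_nth.
Qed.

Lemma content_subP E p : submodule A E -> content A p `<=` E <-> poly_over E p.
Proof.
move=> HE; have E0 : E 0 by case: HE.
split=> [cE|/(poly_over_coefs p E0)]; last exact: span_sub.
by apply/(poly_over_coefs p E0) => x px; exact: cE (sub_span px).
Qed.

Lemma content_coef p i : content A p p`_i.
Proof. by move: i; apply/content_subP => //; apply: span_submodule. Qed.

(** Shifting [g] past the last coefficient of [f] juxtaposes the two
    coefficient lists, so that one polynomial carries both contents. *)
Lemma content_shift_addl f g m :
  (size f <= m)%N -> content A f `<=` content A (f + 'X^m * g).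
Proof.
move=> le_fm; apply/content_subP; first exact: span_submodule.
move=> i; have [lt_im|le_mi] := ltnP i m.
  have := @content_coef (f + 'X^m * g) i.
  by rewrite coefD coefXnM lt_im addr0.
rewrite nth_default; last exact: leq_trans le_fm le_mi.
by case: (span_submodule [set` (f + 'X^m * g : seq T)]).
Qed.

Lemma content_shift_addr f g m :
  (size f <= m)%N -> content A g `<=` content A (f + 'X^m * g).
Proof.
move=> le_fm; apply/content_subP; first exact: span_submodule.
move=> i; have := @content_coef (f + 'X^m * g) (m + i).
rewrite coefD coefXnM ltnNge leq_addr addKn nth_default ?add0r //.
exact: leq_trans le_fm (leq_addr _ _).
Qed.

Lemma scale_submodule z E : submodule A E -> submodule A (scale_set z E).
Proof.
case=> E0 ED EM; split=> [|_ _ [x Ex <-] [y Ey <-]|a _ Aa [x Ex <-]].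
- by exists 0; rewrite ?mulr0.
- by exists (x + y); [apply: ED | rewrite mulrDr].
- by exists (a * x); [apply: EM | rewrite mulrCA].
Qed.

Hypothesis AN1 : A (-1).

Lemma submoduleB E x y : submodule A E -> E x -> E y -> E (x - y).
Proof. by case=> _ ED EM Ex Ey; apply: ED => //; rewrite -mulN1r; apply: EM. Qed.

Lemma submodule_addrK E x y : submodule A E -> E y -> E (x + y) -> E x.
Proof. by move=> HE Ey Exy; rewrite -[x](addrK y); apply: submoduleB. Qed.

(** Gauss's argument: if [f] and [g] both had coefficients outside [Q], take
    the first ones, of indices [i] and [j]; modulo [Q], the coefficient of
    index [i + j] of [f * g] is [f`_i * g`_j]. *)
Lemma poly_over_prime Q f g : submodule A Q ->
    (forall a b, A a -> A b -> Q (a * b) -> Q a \/ Q b) ->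
    poly_over A f -> poly_over A g -> poly_over Q (f * g) ->
  poly_over Q f \/ poly_over Q g.
Proof.
move=> HQ Qprime Af Ag Qfg; apply: contrapT => /not_orP[/existsNP nQf /existsNP nQg].
have least (p : {poly T}) : (exists i, ~ Q p`_i) ->
    exists i, ~ Q p`_i /\ forall j, (j < i)%N -> Q p`_j.
  case=> i0 Qi0; have ex_i : exists i, ~~ `[< Q p`_i >] by exists i0; apply/asboolPn.
  exists (ex_minn ex_i); case: ex_minnP => i /asboolPn nQi min_i.
  split=> // j lt_ji; apply: contrapT => /asboolPn /min_i.
  by rewrite leqNgt lt_ji.
have [i [nQi Qlt_i]] := least _ nQf; have [j [nQj Qlt_j]] := least _ nQg.
have [_ _ QM] := HQ.
have Qij : Q (f`_i * g`_j).
  have := Qfg (i + j)%N; rewrite coefM.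
  have lt_i : (i < (i + j).+1)%N by rewrite ltnS leq_addr.
  rewrite (bigD1 (Ordinal lt_i)) //= addKn; apply: submodule_addrK => //.
  apply: submodule_sum => // k /negP ne_ki.
  have [lt_ki|lt_ik|eq_ki] := ltngtP k i.
  - by rewrite mulrC; apply: QM => //; apply: Qlt_i.
  - apply: QM => //; apply: Qlt_j; rewrite -[ltnRHS](addKn i) ltn_sub2l //.
    exact: leq_trans lt_ik (ltn_ord k).
  - by case: ne_ki; apply/eqP/val_inj.
by case: (Qprime _ _ (Af i) (Ag j) Qij).
Qed.

End SubmodulesOfSubrings.

(** * The finite-type operation attached to a semistar operation *)

Section StarOperation.
Variables (D : idomainType) (star : set {fraction D} -> set {fraction D}).
Hypothesis star_semistar : semistar_operation star.

Local Notation K := {fraction D}.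
Local Notation B := (@base_ring D).
Local Notation star_f := (star_f star).
Implicit Types (E F I J Q : set K) (x y : K).

Lemma base_ring0 : B 0. Proof. by exists 0; rewrite ?tofrac0. Qed.
Lemma base_ring1 : B 1. Proof. by exists 1; rewrite ?tofrac1. Qed.
Lemma base_ringN1 : B (-1).
Proof. by exists (-1); rewrite ?tofracN ?tofrac1. Qed.

Lemma base_ring_submodule : submodule B B.
Proof.
split=> [|_ _ [a _ <-] [b _ <-]|_ _ [a _ <-] [b _ <-]]; first exact: base_ring0.
  by exists (a + b); rewrite ?tofracD.
by exists (a * b); rewrite ?tofracM.
Qed.


Lemma base_ring_fracE x : exists a b, [/\ B a, B b, b != 0 & x = a / b].
Proof.
suff [a [b [b0 ->]]] : exists a b : D, b != 0 /\ x = tofrac a / tofrac b.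
  exists (tofrac a), (tofrac b); split=> //; [by exists a | by exists b |].
  by rewrite tofrac_eq0.
elim/quotW: x => r; exists (frac r).1, (frac r).2.
split; first exact: denom_ratioP.
(* The fraction field is a quotient of the type of pairs, so the identity
   to prove becomes a cross-multiplication of representatives. *)
have rb : tofrac (frac r).2 != 0 :> K by rewrite tofrac_eq0 denom_ratioP.
apply: (canRL (mulfK rb)); rewrite -[_ * _]/(FracField.mul _ _) !piE.
apply/eqmodP; rewrite /= FracField.equivfE !numden_Ratio
  ?mulr1 ?mulf_neq0 ?oner_neq0 ?denom_ratioP //.
by rewrite mulrC.
Qed.

Lemma ideal_eq_base I : ideal B I -> I 1 -> I = B.
Proof.
case=> IB [_ _ IM] I1; rewrite eqEsubset; split=> // a Ba.
by rewrite -[a]mulr1; apply: IM.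
Qed.

Lemma Fbar_neq0 E : Fbar E -> exists2 x, E x & x != 0.
Proof.
case=> -[E0 _ _] nE; apply: contrapT => noE; apply: nE.
rewrite eqEsubset; split=> [x Ex|_ -> //]; apply: contrapT => /eqP x0.
by apply: noE; exists x.
Qed.

Lemma Fbar_of_neq0 E x : submodule B E -> E x -> x != 0 -> Fbar E.
Proof. by move=> HE Ex /eqP x0; split=> // E0; apply: x0; move: Ex; rewrite E0. Qed.

Lemma Fbar_base_ring : Fbar B.
Proof. exact: Fbar_of_neq0 base_ring_submodule base_ring1 (oner_neq0 _). Qed.

Lemma span_fgD (s : seq K) x : x \in s -> x != 0 -> fgD (span B [set` s]).
Proof.
move=> sx x0; split; last by exists s.
by apply: Fbar_of_neq0 x0; [apply: span_submodule | apply: sub_span].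
Qed.

(** The submodule [F'] is the sum of [F] and the span of [s]; the last clause
    is its minimality. *)
Lemma fgD_ext F (s : seq K) : fgD F ->
  exists F', [/\ fgD F', F `<=` F', [set` s] `<=` F' &
    forall E, submodule B E -> F `<=` E -> [set` s] `<=` E -> F' `<=` E].
Proof.
case=> /[dup] FF /Fbar_neq0[x Fx x0] [t defF].
have tF : [set` t] `<=` F by rewrite defF; apply: sub_span.
have ts_sub y : y \in t -> y \in t ++ s by rewrite mem_cat => ->.
exists (span B [set` t ++ s]).
have FF' : F `<=` span B [set` t ++ s].
  rewrite defF; apply: span_sub; first exact: span_submodule.
  by move=> y /ts_sub ty; apply: sub_span.
split=> // [|y sy|E HE FE sE].
- split; last by exists (t ++ s).
  by apply: Fbar_of_neq0 x0; [apply: span_submodule | apply: FF'].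
- by apply: sub_span; rewrite /= mem_cat orbC [y \in s]sy.
- apply: span_sub => // y; rewrite /= mem_cat => /orP[/tF/FE //|]; exact: sE.
Qed.

Lemma star_submodule E : Fbar E -> submodule B (star E).
Proof. by move=> /(semistar_Fbar star_semistar)[]. Qed.

Lemma star_f_mono E F : E `<=` F -> star_f E `<=` star_f F.
Proof. by move=> EF x [G [fgG GE] Gx]; exists G => //; split=> // y /GE/EF. Qed.

Lemma sub_star_f E : Fbar E -> E `<=` star_f E.
Proof.
move=> /[dup] -[HE _] /Fbar_neq0[e Ee e0] x Ex.
have fgF : fgD (span B [set` [:: e; x]]) by apply: span_fgD e0; rewrite mem_head.
exists (span B [set` [:: e; x]]).
  split=> //; apply: span_sub => // y; rewrite /= !inE.
  by case/orP=> /eqP->.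
by apply: (semistar_ext star_semistar fgF.1); apply: sub_span; rewrite /= !inE eqxx orbT.
Qed.

(** The union defining [star_f] is directed, since two finitely generated
    submodules of [E] have a finitely generated sum; hence finitely many
    elements share a witness.  The submodule and idempotence properties of
    [star_f] both come from this. *)
Lemma star_f_directed E (s : seq K) : Fbar E -> [set` s] `<=` star_f E ->
  exists F, [/\ fgD F, F `<=` E & [set` s] `<=` star F].
Proof.
move=> /[dup] FE /Fbar_neq0[e Ee e0]; elim: s => [|x s IHs] sE.
  exists (span B [set` [:: e]]); split=> //.
    by apply: span_fgD e0; rewrite mem_head.
  by apply: span_sub FE.1 _ => y; rewrite /= inE => /eqP->.
have [|F [fgF FsubE sF]] := IHs.
  by move=> y sy; apply: sE; rewrite /= inE [y \in s]sy orbT.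
have [|G [fgG GE] Gx] := sE x; first by rewrite /= mem_head.
have [_ [t defG]] := fgG.
have [F' [fgF' FF' tF' F'min]] := fgD_ext t fgF.
have GF' : G `<=` F' by rewrite defG; apply: span_sub fgF'.1.1 _.
exists F'; split=> //.
  by apply: F'min FE.1 _ _ => // y ty; apply: GE; rewrite defG; apply: sub_span.
move=> y; rewrite /= inE => /predU1P[->|sy].
  exact: (semistar_mono star_semistar fgG.1 fgF'.1 GF').
exact: (semistar_mono star_semistar fgF.1 fgF'.1 FF') (sF y sy).
Qed.

Lemma star_f_submodule E : Fbar E -> submodule B (star_f E).
Proof.
move=> FE; split=> [|x y Ex Ey|a x Ba [F [fgF FsubE] Fx]].
- by apply: (sub_star_f FE); case: FE => -[].
- have [|F [fgF FsubE xyF]] := @star_f_directed E [:: x; y] FE.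
    by move=> z; rewrite /= !inE => /orP[]/eqP->.
  exists F => //; have [_ FD _] := star_submodule fgF.1.
  by apply: FD; apply: xyF; rewrite /= !inE eqxx ?orbT.
- by exists F => //; have [_ _ FM] := star_submodule fgF.1; apply: FM.
Qed.

Lemma star_f_idem E : Fbar E -> star_f (star_f E) `<=` star_f E.
Proof.
move=> FE x [G [fgG GE] Gx]; have [_ [t defG]] := fgG.
have [|F [fgF FE' tF]] := @star_f_directed E t FE.
  by move=> y ty; apply: GE; rewrite defG; apply: sub_span.
exists F => //.
have GF : G `<=` star F.
  by rewrite defG; apply: span_sub (star_submodule fgF.1) _.
rewrite -(semistar_idem star_semistar fgF.1).
exact: (semistar_mono star_semistar fgG.1 (semistar_Fbar star_semistar fgF.1) GF).
Qed.

(** A quasi-[star_f]-ideal is what [star_f] closure followed by contraction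
    produces; idempotence makes this operation a closure on ideals. *)
Lemma quasi_star_f_ideal_star_f I :
  ideal B I -> Fbar I -> quasi_star_f_ideal star (star_f I `&` B).
Proof.
move=> [IB HI] FI; have HfI := star_f_submodule FI.
have I_sub : I `<=` star_f I `&` B by move=> x Ix; split; [apply: sub_star_f | apply: IB].
have HJ : submodule B (star_f I `&` B).
  case: HfI => f0 fD fM; case: base_ring_submodule => B0 BD BM.
  split=> [//|x y [fx Bx] [fy By]|a x Ba [fx Bx]]; first by split; [apply: fD|apply: BD].
  by split; [apply: fM|apply: BM].
have [e Ie e0] := Fbar_neq0 FI.
have FJ := Fbar_of_neq0 HJ (I_sub _ Ie) e0.
split; [by split=> // x [] | exact: FJ.2 |].
rewrite eqEsubset; split=> [x [fx Bx]|x Jx]; last by split; [apply: sub_star_f|case: Jx].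
split=> //; apply: star_f_idem => //; move: fx; apply: star_f_mono.
by move=> y [].
Qed.

(** Zorn's lemma on the ideals [J] containing [I] with [~ star_f J 1].  Chains
    have upper bounds because a finitely generated submodule of the union of a
    chain lies in one member.  A maximal such [J] equals its own closure
    [star_f J `&` B], which still omits [1]. *)
Lemma Mstar_f_above I :
  ideal B I -> Fbar I -> ~ star_f I 1 -> exists2 Q, Mstar_f star Q & I `<=` Q.
Proof.
move=> [IB HI] FI nI1; have [e Ie e0] := Fbar_neq0 FI.
(* The union with [I] accommodates the empty chain, whose union is [set0];
   for the same reason [set0] is adjoined to the chain in [dir] below. *)
pose P X := ideal B (I `|` X) /\ ~ star_f (I `|` X) 1.
have P0 : P set0 by rewrite /P setU0.
have [F FP Ftot|X [[idQ nQ1] Xmax]] := @Zorn_bigcup K P.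
  set U := \bigcup_(X in F) X.
  have dir (s : seq K) : [set` s] `<=` I `|` U ->
      exists X, [/\ F X \/ X = set0, P X, X `<=` U & [set` s] `<=` I `|` X].
    elim: s => [_|x s IHs sU]; first by exists set0; split=> //; right.
    have [|X [FX PX XU sX]] := IHs.
      by move=> y sy; apply: sU; rewrite /= inE [y \in s]sy orbT.
    have sX_in Y : X `<=` Y -> (I `|` Y) x -> [set` x :: s] `<=` I `|` Y.
      move=> XY Yx y; rewrite /= inE => /predU1P[-> //|/sX[]]; first by left.
      by move=> /XY; right.
    have [Ix|[Y FY Yx]] : (I `|` U) x by apply: sU; rewrite /= mem_head.
      by exists X; split=> //; apply: sX_in => //; left.
    have YU : Y `<=` U by move=> y Yy; exists Y.
    have [XY|YX] : X `<=` Y \/ Y `<=` X.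
      by case: FX => [FX|->]; [apply: Ftot | left].
    - exists Y; split=> //; [by left | exact: FP | by apply: sX_in => //; right].
    - by exists X; split=> //; apply: sX_in => //; right; apply: YX.
  have sub_IU X : X `<=` U -> I `|` X `<=` I `|` U by move=> XU; apply: setUS.
  split.
    split=> [x [/IB //|[X /FP[[XB _] _] Xx]]|]; first by apply: XB; right.
    split=> [|x y Ux Uy|a x Ba Ux]; first by left; case: HI.
      have [z|X [_ [[_ [_ XD _]] _] XU sX]] := dir [:: x; y].
        by rewrite /= !inE => /orP[]/eqP->.
      by apply: sub_IU XU _ _; apply: XD; apply: sX; rewrite /= !inE eqxx ?orbT.
    have [z|X [_ [[_ [_ _ XM]] _] XU sX]] := dir [:: x].
      by rewrite /= !inE => /eqP->.
    by apply: sub_IU XU _ _; apply: XM => //; apply: sX; rewrite /= mem_head.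
  move=> [G [fgG GU] G1]; have [_ [t defG]] := fgG.
  have [z tz|X [_ [[_ HX] nX1] _ tX]] := dir t.
    by apply: GU; rewrite defG; apply: sub_span.
  apply: nX1; exists G => //; split=> //.
  by rewrite defG; apply: span_sub.
set Q := I `|` X in idQ nQ1.
have IQ : I `<=` Q by left.
have FQ : Fbar Q by apply: Fbar_of_neq0 idQ.2 (IQ _ Ie) e0.
have Qmax J : ideal B J -> Q `<=` J -> ~ star_f J 1 -> J = Q.
  move=> idJ QJ nJ1; apply: contrapT => neJQ; apply: (Xmax J).
    split=> [|JX]; first by move=> x Xx; apply: QJ; right.
    by apply: neJQ; rewrite eqEsubset; split=> // x /JX; right.
  by rewrite /P (setUidr (subset_trans IQ QJ)).
have [idQ' _ _] := quasi_star_f_ideal_star_f idQ FQ.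
have defQ : star_f Q `&` B = Q.
  apply: Qmax => // [x Qx|f1]; first by split; [apply: sub_star_f|apply: idQ.1].
  by apply: nQ1; apply: star_f_idem => //; apply: star_f_mono f1 => y [].
exists Q => //; split.
  split; first by rewrite -defQ; apply: quasi_star_f_ideal_star_f.
  move=> QB; apply: nQ1; apply: sub_star_f => //.
  by rewrite QB; apply: base_ring1.
move=> N [[idN _ defN] neNB] QN; apply: Qmax => // N1; apply: neNB.
apply: ideal_eq_base => //; rewrite -defN; split=> //; exact: base_ring1.
Qed.

Section MaximalQuasiIdeal.
Variable Q : set K.
Hypothesis MQ : Mstar_f star Q.

Lemma Mstar_f_ideal : ideal B Q. Proof. by case: MQ => -[[]]. Qed.

Lemma Mstar_f_Fbar : Fbar Q.
Proof. by case: MQ => -[[[_ HQ] Q0 _] _] _; split. Qed.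

Lemma Mstar_f_proper : ~ star_f Q 1.
Proof.
case: MQ => -[[idQ _ defQ] neQB] _ Q1; apply: neQB.
apply: ideal_eq_base => //; rewrite -defQ; split=> //; exact: base_ring1.
Qed.

Lemma Mstar_f_neq1 : ~ Q 1.
Proof. by move/(sub_star_f Mstar_f_Fbar); apply: Mstar_f_proper. Qed.

Lemma Mstar_f_maximal I : ideal B I -> Q `<=` I -> ~ star_f I 1 -> I = Q.
Proof.
move=> idI QI nI1; have [e Qe e0] := Fbar_neq0 Mstar_f_Fbar.
have FI : Fbar I := Fbar_of_neq0 idI.2 (QI _ Qe) e0.
have [N MN IN] := Mstar_f_above idI FI nI1.
have defN : N = Q by apply: MQ.2 (subset_trans QI IN); apply: MN.1.
by rewrite eqEsubset; split=> //; rewrite -defN.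
Qed.

(** If [x] is not in [Q], the ideal [I] of the [z] with [z * y] in [Q] is
    strictly larger than [Q], so [1] is in [star F] for some finitely generated
    [F] inside [I].  Then [y] is in [y (star F) = star (y F)], and [y F] lies
    in [Q], so [y] is in [star_f Q]. *)
Lemma Mstar_f_prime x y : B x -> B y -> Q (x * y) -> Q x \/ Q y.
Proof.
move=> Bx By Qxy; apply: contrapT => /not_orP[nQx nQy].
have [QB HQ] := Mstar_f_ideal; have [Q0 QD QM] := HQ.
have [B0 BD BM] := base_ring_submodule.
have y0 : y != 0 by apply/eqP=> y0; apply: nQy; rewrite y0.
pose I := [set z | B z /\ Q (z * y)].
have HI : submodule B I.
  split=> [|z t [Bz Qz] [Bt Qt]|a z Ba [Bz Qz]]; first by split=> //; rewrite mul0r.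
    by split; [apply: BD | rewrite mulrDl; apply: QD].
  by split; [apply: BM | rewrite -mulrA; apply: QM].
have QI : Q `<=` I by move=> z Qz; split; [apply: QB|rewrite mulrC; apply: QM].
have [F [fgF FI] F1] : star_f I 1.
  apply: contrapT => nI1; apply: nQx; rewrite -(Mstar_f_maximal _ QI nI1) //.
  by split=> // z [].
have [_ [t defF]] := fgF; have [x0 Fx0 nz_x0] := Fbar_neq0 fgF.1.
apply: nQy; case: MQ => -[[_ _ <-] _] _; split=> //.
(* [G] is [y F], presented by generators so as to be visibly finitely
   generated. *)
pose G := span B [set` [seq y * z | z <- t]].
have FG z : F z -> G (y * z).
  have [G0 GD GM] : submodule B G by apply: span_submodule.
  have HG : submodule B [set z | G (y * z)].
    split=> [|u v Gu Gv|a u Ba Gu] /=; first by rewrite mulr0.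
      by rewrite mulrDr; apply: GD.
    by rewrite mulrCA; apply: GM.
  move: z; rewrite defF; apply: (span_sub HG) => z tz.
  by apply: sub_span; apply: map_f.
have GQ : G `<=` Q.
  apply: span_sub => // _ /mapP[z tz ->]; rewrite mulrC.
  by have [] : I z by apply: FI; rewrite defF; apply: sub_span.
have FbG : Fbar G.
  by apply: Fbar_of_neq0 (span_submodule _ _) (FG _ Fx0) _; rewrite mulf_neq0.
exists G; first by split=> //; split=> //; exists [seq y * z | z <- t].
have FbyF : Fbar (scale_set y F).
  apply: Fbar_of_neq0 (scale_submodule y fgF.1.1) _ (mulf_neq0 y0 nz_x0).
  by exists x0.
suff : star (scale_set y F) y.
  by apply: (semistar_mono star_semistar) => // _ [z Fz <-]; apply: FG.
rewrite (semistar_scale star_semistar) //; last exact: fgF.1.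
by exists 1; rewrite ?mulr1.
Qed.

End MaximalQuasiIdeal.

Hypothesis star_nontrivial : ~ trivial_semistar star.

(** If every nonzero [x] in [B] had its inverse in [star B], then [star B]
    would be the whole field and, by scaling, so would every [star E].
    Otherwise the principal ideal generated by an [x] whose inverse is missing
    satisfies the hypothesis of [Mstar_f_above]. *)
Lemma Mstar_f_nonempty : exists Q, Mstar_f star Q.
Proof.
have [_ SD SM] := star_submodule Fbar_base_ring.
have [x [Bx x0 nVx]] : exists x, [/\ B x, x != 0 & ~ star B x^-1].
  apply: contrapT => allV; apply: star_nontrivial => E FE.
  have SV x : B x -> x != 0 -> star B x^-1.
    by move=> Bx x0; apply: contrapT => nVx; apply: allV; exists x.
  have [e Ee e0] := Fbar_neq0 FE; have [_ _ EM] := FE.1.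
  rewrite eqEsubset; split=> // z _.
  have BeE : scale_set e B `<=` E by move=> _ [a Ba <-]; rewrite mulrC; apply: EM.
  have FeB : Fbar (scale_set e B).
    apply: Fbar_of_neq0 (scale_submodule e base_ring_submodule) _ e0.
    by exists 1; rewrite ?mulr1 //; apply: base_ring1.
  apply: (semistar_mono star_semistar FeB FE BeE).
  rewrite (semistar_scale star_semistar) //; last exact: Fbar_base_ring.
  exists (e^-1 * z); last by rewrite mulVKf.
  have [a [b [Ba Bb b0 ->]]] := base_ring_fracE (e^-1 * z).
  by apply: SM => //; apply: SV.
pose I := scale_set x B.
have idI : ideal B I.
  have [B0 BD BM] := base_ring_submodule.
  split; first by move=> _ [a Ba <-]; apply: BM.
  exact: scale_submodule base_ring_submodule.
have FI : Fbar I.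
  apply: Fbar_of_neq0 idI.2 _ x0.
  by exists 1; rewrite ?mulr1 //; apply: base_ring1.
suff /(Mstar_f_above idI FI)[Q MQ _] : ~ star_f I 1 by exists Q.
move=> [F [fgF FsubI] F1]; apply: nVx.
have : star I 1 by apply: (semistar_mono star_semistar fgF.1 FI FsubI).
rewrite (semistar_scale star_semistar) //; last exact: Fbar_base_ring.
by case=> z Sz xz1; rewrite -[x^-1]mulr1 -xz1 mulKf.
Qed.

End StarOperation.

(** * Rings of fractions *)

(** Evaluating [phi f] monomial by monomial shows that the extension of an
    ideal [I] of coefficients contains all of [I[X]]. *)
Lemma submodule_poly_image (R T : comNzRingType) (phi : {rmorphism {poly R} -> T})
    (A E : set T) (I : set R) (f : {poly R}) : submodule A E ->
    (forall i, A (phi 'X^i)) -> (forall x, I x -> E (phi x%:P)) ->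
  poly_over I f -> E (phi f).
Proof.
move=> HE AX EI If; rewrite -[f]coefK poly_def rmorph_sum.
apply: (submodule_sum HE) => i _; rewrite -mul_polyC mulrC rmorphM.
by have [_ _ EM] := HE; apply: EM; [apply: AX | apply/EI/If].
Qed.

Section Fractions.
Variable R : idomainType.
Implicit Types (A I S : set R) (f g : R).

Definition fractions I S : set {fraction R} :=
  [set r | exists f g, [/\ I f, S g & r = tofrac f / tofrac g]].

Lemma fractions_tofrac I S f : I f -> S 1 -> fractions I S (tofrac f).
Proof.
by move=> If S1; exists f, 1; split; [exact: If | exact: S1 | rewrite tofrac1 divr1].
Qed.

Lemma fractions_inv I S g : I 1 -> S g -> fractions I S (tofrac g)^-1.
Proof.
by move=> I1 Sg; exists 1, g; split; [exact: I1 | exact: Sg | rewrite tofrac1 mul1r].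
Qed.

Lemma tofrac_div_inj f g f' g' : g != 0 -> g' != 0 ->
  tofrac f / tofrac g = tofrac f' / tofrac g' -> f * g' = f' * g.
Proof.
move=> g0 g'0 /eqP; rewrite eqr_div ?tofrac_eq0 // -!tofracM tofrac_eq.
by move/eqP.
Qed.

Lemma fractions_submodule A I S : submodule A I -> S `<=` A -> S 1 ->
    (forall f g, S f -> S g -> S (f * g)) -> ~ S 0 ->
  submodule (fractions A S) (fractions I S).
Proof.
move=> [I0 ID IM] SA S1 SM S0; have nz g : S g -> tofrac g != 0.
  by rewrite tofrac_eq0; apply: contraPneq => ->.
split=> [|_ _ [f [g [If Sg ->]]] [f' [g' [If' Sg' ->]]]
         |_ _ [f [g [Af Sg ->]]] [f' [g' [If' Sg' ->]]]].
- by exists 0, 1; split=> //; rewrite tofrac0 mul0r.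
- exists (f * g' + f' * g), (g * g'); split; last 1 first.
  + by rewrite addf_div ?nz // tofracD !tofracM.
  + by rewrite mulrC [f' * g]mulrC; apply: ID; apply: IM => //; apply: SA.
  + exact: SM.
- exists (f * f'), (g * g'); split; [exact: IM | exact: SM |].
  by rewrite !tofracM mulf_div.
Qed.

End Fractions.

(** * The Nagata ring of the localization at a prime ideal *)

Section PrimeLocalization.
Variables (D : idomainType) (Q : set {fraction D}).
Local Notation K := {fraction D}.
Local Notation KX := {fraction {poly {fraction D}}}.
Local Notation B := (@base_ring D).
Implicit Types (I : set K) (x y s : K) (f g : {poly K}).

Hypothesis idealQ : ideal B Q.
Hypothesis Q_neq1 : ~ Q 1.
Hypothesis Q_prime : forall x y, B x -> B y -> Q (x * y) -> Q x \/ Q y.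

Local Notation BX := (poly_over B).
Local Notation QX := (poly_over Q).
Local Notation locQ := (localization Q).

Lemma prime_complementM x y : B x -> B y -> ~ Q x -> ~ Q y -> ~ Q (x * y).
Proof. by move=> Bx By nQx nQy /(Q_prime Bx By)[]. Qed.

Lemma prime_complement_neq0 x : ~ Q x -> x != 0.
Proof. by apply: contra_not_neq => ->; case: idealQ => _ []. Qed.

(** The extension of [I] to the localization at [Q], written by clearing
    denominators rather than with quotients, so that closure under sums needs
    no manipulation of fractions. *)
Definition localized I : set K :=
  [set x | exists s, [/\ B s, ~ Q s & I (s * x)]].

Lemma localized_base : locQ = localized B.
Proof.
rewrite eqEsubset; split=> [_ [a [s [Ba Bs nQs ->]]]|x [s [Bs nQs Bsx]]].
  by exists s; split=> //; rewrite mulrC mulfVK ?prime_complement_neq0.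
exists (s * x), s; split=> //.
by rewrite mulrC mulKf ?prime_complement_neq0.
Qed.

Lemma localized_submodule I : submodule B I -> submodule locQ (localized I).
Proof.
move=> [I0 ID IM]; have [_ _ BM] := base_ring_submodule D.
rewrite localized_base; split=> [|x y [s [Bs nQs Isx]] [t [Bt nQt Ity]]
    |a x [s [Bs nQs Bsa]] [t [Bt nQt Itx]]].
- by exists 1; split=> //; [apply: base_ring1 | rewrite mulr0].
- exists (s * t); split; [exact: BM | exact: prime_complementM |].
  by rewrite mulrDr {1}[s * t]mulrC -!mulrA; apply: ID; apply: IM.
- exists (s * t); split; [exact: BM | exact: prime_complementM |].
  by rewrite mulrACA; apply: IM.
Qed.

Lemma common_denominator f : poly_over locQ f ->
  exists s, [/\ B s, ~ Q s & BX (s *: f)].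
Proof.
rewrite localized_base => locf; have [_ _ BM] := base_ring_submodule D.
have [s [Bs nQs Bsf]] : exists s, [/\ B s, ~ Q s &
    forall i, (i < size f)%N -> B (s * f`_i)].
  elim: (size f) => [|n [s [Bs nQs Bsf]]].
    by exists 1; split=> //; apply: base_ring1.
  have [t [Bt nQt Btf]] := locf n.
  exists (s * t); split; [exact: BM | exact: prime_complementM |] => i.
  rewrite ltnS leq_eqVlt => /predU1P[-> | lt_in]; first by rewrite -mulrA; apply: BM.
  by rewrite mulrAC mulrC; apply: BM => //; apply: Bsf.
exists s; split=> // i; rewrite coefZ.
have [/Bsf //|/(nth_default 0) ->] := ltnP i (size f).
by rewrite mulr0; apply: base_ring0.
Qed.

Lemma prime_poly_complementM f g :
  (BX `\` QX) f -> (BX `\` QX) g -> (BX `\` QX) (f * g).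
Proof.
move=> [Bf nQf] [Bg nQg]; split.
  by have [_ _] := poly_over_submodule (base_ring_submodule D); apply.
by move=> /(poly_over_prime (base_ringN1 D) idealQ.2 Q_prime Bf Bg)[].
Qed.

Lemma base_poly1 : BX 1.
Proof. exact: (poly_overXn 0 (base_ring0 D) (base_ring1 D)). Qed.

Lemma prime_poly_complement1 : (BX `\` QX) 1.
Proof.
by split=> [|/(_ 0%N)]; [apply: base_poly1 | rewrite coef1].
Qed.

Lemma prime_poly_complement0 : ~ (BX `\` QX) 0.
Proof. by case=> _; apply; case: (poly_over_submodule idealQ.2). Qed.

(** After clearing denominators, a polynomial over [D_Q] has unit content if
    and only if one of its coefficients is outside [Q], as [D_Q] is local with
    maximal ideal [localized Q]. *)
Lemma Nagata_localizationE : Nagata locQ = fractions BX (BX `\` QX).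
Proof.
have [_ _ BM] := base_ring_submodule D.
have [B0 B1] := (base_ring0 D, base_ring1 D).
have Hloc : submodule locQ locQ.
  by rewrite {2}localized_base; apply/localized_submodule/base_ring_submodule.
rewrite eqEsubset; split=> [_ [f [g [locf locg cg ->]]]|_ [f [g [Bf [Bg nQg] ->]]]].
  have [s [Bs nQs Bsf]] := common_denominator locf.
  have [t [Bt nQt Btg]] := common_denominator locg.
  have [nQst st0] : ~ Q (s * t) /\ (s * t)%:P != 0.
    split; first exact: prime_complementM.
    by rewrite polyC_eq0 mulf_neq0 ?prime_complement_neq0.
  exists ((s * t) *: f), ((s * t) *: g); split.
  - by move=> i; rewrite [s * t]mulrC -scalerA coefZ; apply: BM.
  - split=> [i|Qg]; first by rewrite -scalerA coefZ; apply: BM.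
    have : locQ 1 by exists 1, 1; split=> //; rewrite divr1.
    rewrite -cg => c1; have [s' [Bs' nQs']] : localized Q 1.
      move: c1; apply: (content_subP _ (localized_submodule idealQ.2)).2 => i.
      by exists (s * t); split=> //; [apply: BM | rewrite -coefZ].
    by rewrite mulr1.
  - rewrite /polyfrac -!mul_polyC !tofracM -mulf_div divff ?mul1r //.
    by rewrite tofrac_eq0.
have locB x : B x -> locQ x by move=> Bx; exists x, 1; split=> //; rewrite divr1.
exists f, g; split=> //; [by move=> i; apply: locB | by move=> i; apply: locB |].
have [i nQi] : exists i, ~ Q g`_i by apply/existsNP.
rewrite eqEsubset; split.
  by apply: (content_subP _ Hloc).2 => j; apply: locB.
move=> _ [a [s [Ba Bs nQs ->]]].
have -> : a / s = a / (s * g`_i) * g`_i.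
  by rewrite invfM mulrA mulfVK ?prime_complement_neq0.
have [_ _ cM] := @span_submodule _ locQ [set` (g : seq K)].
apply: cM; last exact: content_coef.
by exists a, (s * g`_i); split=> //; [apply: BM | apply: prime_complementM].
Qed.

(** Fractions with numerator in [Q[X]] form an ideal of the Nagata ring that
    contains the constants in [Q]; conversely a polynomial over [Q] is a
    combination of such constants with the powers of [X] as coefficients. *)
Lemma extension_to_NagataE : extension_to_Nagata Q = fractions QX (BX `\` QX).
Proof.
rewrite /extension_to_Nagata Nagata_localizationE.
have [B0 B1] := (base_ring0 D, base_ring1 D).
have [S1 S0] := (prime_poly_complement1, prime_poly_complement0).
rewrite eqEsubset; split.
  have SB : BX `\` QX `<=` BX by move=> f [].
  apply: (span_sub (fractions_submodule (poly_over_submodule idealQ.2) SB S1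
    prime_poly_complementM S0)).
  move=> _ [q Qq <-]; apply: fractions_tofrac S1.
  by apply: poly_overC Qq; case: idealQ => _ [].
move=> _ [f [g [Qf Sg ->]]].
set E := span _ _; have HE : submodule (fractions BX (BX `\` QX)) E.
  exact: span_submodule.
have [_ _ EM] := HE; rewrite mulrC; apply: EM; first exact: fractions_inv base_poly1 Sg.
apply: (submodule_poly_image (phi := @tofrac {poly K}) HE _ _ Qf) => [i|q Qq].
  exact: fractions_tofrac (poly_overXn _ B0 B1) S1.
by apply: sub_span; exists q.
Qed.

End PrimeLocalization.

(** * The Nagata ring of a semistar operation *)

Section NagataRing.
Variables (D : idomainType) (star : set {fraction D} -> set {fraction D}).
Hypothesis star_semistar : semistar_operation star.

Local Notation K := {fraction D}.
Local Notation B := (@base_ring D).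
Local Notation BX := (poly_over B).
Local Notation star_f := (star_f star).
Implicit Types (Q I : set K) (f g h : {poly K}).

(** The denominators of [Na star] (see [star_primitiveP]).  Phrasing the
    content condition with [star_f] makes it monotone in the content and
    excludes [g = 0], since no nonzero submodule lies in the zero content. *)
Definition star_primitive : set {poly K} :=
  [set g | BX g /\ star_f (content B g) 1].

Lemma content_fgD g : g != 0 -> fgD (content B g).
Proof.
move=> g0; apply: (@span_fgD _ _ (lead_coef g)); last by rewrite lead_coef_eq0.
by rewrite lead_coefE mem_nth // prednK // size_poly_gt0.
Qed.

Lemma content0 : content B 0 = [set 0].
Proof.
rewrite eqEsubset; split=> [|_ ->]; last by have [] := @span_submodule _ B [set` (0 : {poly K}) : seq K].
apply/content_subP => [|i]; last by rewrite coef0.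
by split=> // [x y -> ->|a x _ ->]; rewrite ?addr0 ?mulr0.
Qed.

Lemma star_primitive_neq0 g : star_primitive g -> g != 0.
Proof.
case=> _ [F [fgF Fg] _]; apply/eqP=> g0.
have [x /Fg] := Fbar_neq0 fgF.1; rewrite g0 content0 => ->.
by rewrite eqxx.
Qed.

Lemma star_primitiveP g : BX g ->
  star_primitive g <-> g != 0 /\ star (content B g) = star B.
Proof.
move=> Bg; have FB := Fbar_base_ring D; split=> [pg|[g0 cg]].
  have g0 := star_primitive_neq0 pg; split=> //; have [Fc _] := content_fgD g0.
  have cB : content B g `<=` B by apply/content_subP => //; apply: base_ring_submodule.
  have [_ [F [fgF Fc'] F1]] := pg.
  have c1 : star (content B g) 1.
    exact: (semistar_mono star_semistar fgF.1 Fc Fc').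
  rewrite eqEsubset; split; first exact: (semistar_mono star_semistar).
  rewrite -[X in _ `<=` X](semistar_idem star_semistar Fc).
  apply: (semistar_mono star_semistar) => //; first exact: (semistar_Fbar star_semistar).
  have [_ _ sM] := star_submodule star_semistar Fc.
  by move=> a Ba; rewrite -[a]mulr1; apply: sM.
split=> //; exists (content B g); first by split=> //; apply: content_fgD.
by rewrite cg; apply: (semistar_ext star_semistar FB); apply: base_ring1.
Qed.

Lemma NaE : Na star = fractions BX star_primitive.
Proof.
rewrite eqEsubset; split=> [_ [f [g [Bf Bg g0 cg ->]]]|_ [f [g [Bf pg ->]]]].
  by exists f, g; split=> //; apply/(star_primitiveP Bg).
have [g0 cg] := (star_primitiveP pg.1).1 pg.
by exists f, g; split=> //; case: pg.
Qed.

Hypothesis star_nontrivial : ~ trivial_semistar star.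

(** One direction holds because [star_f Q] omits [1]; the other is
    [Mstar_f_above] applied to the content of [g].  For [g = 0], which lies in
    every [Q[X]], what matters is that some [Q] exists. *)
Lemma star_primitive_avoids g :
  star_primitive g <->
  BX g /\ forall Q, Mstar_f star Q -> ~ poly_over Q g.
Proof.
split=> [[Bg cg1]|[Bg nQg]].
  split=> // Q MQ Qg; apply: (Mstar_f_proper MQ).
  move: cg1; apply: star_f_mono; apply/content_subP => //.
  exact: (Mstar_f_ideal MQ).2.
split=> //; apply: contrapT => nc1.
have g0 : g != 0.
  apply/eqP => g0; have [Q MQ] := Mstar_f_nonempty star_semistar star_nontrivial.
  apply: (nQg Q MQ); rewrite g0.
  by case: (poly_over_submodule (Mstar_f_ideal MQ).2).
have HB := base_ring_submodule D.
have idc : ideal B (content B g).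
  by split; [apply/content_subP | apply: span_submodule].
have [Q MQ cQ] := Mstar_f_above star_semistar idc (content_fgD g0).1 nc1.
by apply: (nQg Q MQ); apply: (content_subP g (Mstar_f_ideal MQ).2).1 cQ.
Qed.

Section OnePrime.
Variable Q : set K.
Hypothesis MQ : Mstar_f star Q.

Let idealQ : ideal B Q := Mstar_f_ideal MQ.
Let Q_neq1 : ~ Q 1 := Mstar_f_neq1 star_semistar MQ.
Let Q_prime := Mstar_f_prime star_semistar MQ.
Local Notation PQ := (extension_to_Nagata Q `&` Na star).

Lemma star_primitive_sub_complement : star_primitive `<=` BX `\` poly_over Q.
Proof. by move=> g /star_primitive_avoids[Bg nQg]; split=> //; apply: nQg. Qed.

(** If [f / g = f' / g'] with [f'] in [Q[X]] and [g'] outside it, then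
    [f * g' = f' * g] is in [Q[X]], which is prime. *)
Lemma trace_mem f g : BX f -> star_primitive g ->
  PQ (tofrac f / tofrac g) <-> poly_over Q f.
Proof.
move=> Bf pg; rewrite (extension_to_NagataE idealQ Q_neq1 Q_prime) NaE.
have Sg := star_primitive_sub_complement pg.
split=> [[[f' [g' [Qf' [Bg' nQg'] eq_r]]] _]|Qf]; last first.
  by split; exists f, g.
have fg' : f * g' = f' * g.
  apply: tofrac_div_inj eq_r; first exact: star_primitive_neq0.
  apply/eqP => g'0; apply: nQg'; rewrite g'0.
  by case: (poly_over_submodule idealQ.2).
have [_ _ QXM] := poly_over_submodule idealQ.2.
have Qfg' : poly_over Q (f * g') by rewrite fg' mulrC; apply: QXM => //; case: pg.
by have [] := poly_over_prime (base_ringN1 D) idealQ.2 Q_prime Bf Bg' Qfg'.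
Qed.

End OnePrime.

Lemma star_primitive1 : star_primitive 1.
Proof.
apply/star_primitive_avoids; split=> [|Q MQ]; first exact: (base_poly1 D).
exact: (prime_poly_complement1 (Mstar_f_neq1 star_semistar MQ)).2.
Qed.

Lemma star_primitiveM f g :
  star_primitive f -> star_primitive g -> star_primitive (f * g).
Proof.
move=> pf pg; apply/star_primitive_avoids; split=> [|Q MQ].
  have [_ _] := poly_over_submodule (base_ring_submodule D).
  by apply; [case: pf | case: pg].
apply: (prime_poly_complementM (Mstar_f_ideal MQ) (Mstar_f_prime star_semistar MQ) _ _).2.
  exact: star_primitive_sub_complement MQ _ pf.
exact: star_primitive_sub_complement MQ _ pg.
Qed.

Lemma Na_fractions_submodule I : submodule B I ->
  submodule (Na star) (fractions (poly_over I) star_primitive).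
Proof.
move=> HI; rewrite NaE; apply: fractions_submodule.
- exact: poly_over_submodule.
- by move=> g [].
- exact: star_primitive1.
- exact: star_primitiveM.
- by move/star_primitive_neq0; rewrite eqxx.
Qed.

Lemma Na1 : Na star 1.
Proof.
by rewrite NaE -(@tofrac1 {poly K}); apply: fractions_tofrac (base_poly1 D) star_primitive1.
Qed.

Lemma Na_poly f : BX f -> Na star (tofrac f).
Proof. by move=> Bf; rewrite NaE; apply: fractions_tofrac Bf star_primitive1. Qed.

Lemma Na_inv g : star_primitive g -> Na star (tofrac g)^-1.
Proof. by move=> pg; rewrite NaE; apply: fractions_inv (base_poly1 D) pg. Qed.

Lemma trace_proper_ideal Q : Mstar_f star Q ->
  ideal (Na star) (extension_to_Nagata Q `&` Na star) /\
  extension_to_Nagata Q `&` Na star <> Na star.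
Proof.
move=> MQ; have idQ := Mstar_f_ideal MQ; split.
  split; first by move=> r [].
  have -> : extension_to_Nagata Q `&` Na star = fractions (poly_over Q) star_primitive.
    rewrite eqEsubset; split=> [r [Er Nr]|_ [f [g [Qf pg ->]]]].
      move: (Nr) Er; rewrite {1}NaE => -[f [g [Bf pg ->]]] Er.
      exists f, g; split=> //; apply/(trace_mem MQ Bf pg); split=> //.
      by rewrite NaE; exists f, g.
    by apply/(trace_mem MQ _ pg) => // i; apply: idQ.1.
  exact: Na_fractions_submodule idQ.2.
move=> eqN; have := Na1; rewrite -eqN.
have -> : 1 = tofrac 1 / tofrac 1 :> {fraction {poly K}} by rewrite tofrac1 divr1.
move=> /(trace_mem MQ (base_poly1 D) star_primitive1).
exact: (prime_poly_complement1 (Mstar_f_neq1 star_semistar MQ)).2.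
Qed.

Lemma trace_sub Q Q' : Mstar_f star Q -> Mstar_f star Q' ->
  extension_to_Nagata Q `&` Na star `<=` extension_to_Nagata Q' `&` Na star ->
  Q `<=` Q'.
Proof.
move=> MQ MQ' QQ' q Qq; have [QB [Q0 _ _]] := Mstar_f_ideal MQ.
have Qc : poly_over Q q%:P by apply: poly_overC.
have Bc : BX q%:P by move=> i; apply: QB.
have /(trace_mem MQ Bc star_primitive1)/QQ' := Qc.
by move=> /(trace_mem MQ' Bc star_primitive1)/(_ 0%N); rewrite coefC.
Qed.

(** The union [I] of the contents of the polynomials in [J] is directed,
    because [h + X^(size h) * k] dominates both [h] and [k].  Thus
    [star_f I 1] would give a star-primitive polynomial in [J], that is, a
    unit of [Na star]. *)
Lemma proper_ideal_sub_trace J : ideal (Na star) J -> J <> Na star ->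
  exists2 Q, Mstar_f star Q & J `<=` extension_to_Nagata Q `&` Na star.
Proof.
move=> [JN [J0 JD JM]] neJN; have HB := base_ring_submodule D.
pose JX := [set h | BX h /\ J (tofrac h)].
have JX_shift f g : JX f -> JX g -> JX (f + 'X^(size f) * g).
  have BXn n : BX 'X^n.
    exact: (poly_overXn n (base_ring0 D) (base_ring1 D)).
  have [_ BD BM] := poly_over_submodule HB.
  move=> [Bf Jf] [Bg Jg]; split; first by apply: BD => //; apply: BM.
  by rewrite tofracD tofracM; apply: JD => //; apply: JM => //; apply: Na_poly.
have JX0 : JX 0 by split; [case: (poly_over_submodule HB) | rewrite tofrac0].
have JX_notprim h : JX h -> ~ star_primitive h.
  move=> [Bh Jh] ph; apply: neJN; rewrite eqEsubset; split=> // r Nr.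
  have h0 : tofrac h != 0 by rewrite tofrac_eq0; apply: star_primitive_neq0.
  rewrite -[r](mulfVK h0); apply: (JM) => //.
  have [_ _ NM] := Na_fractions_submodule HB; rewrite -NaE in NM.
  by apply: NM => //; apply: Na_inv.
pose I := \bigcup_(h in JX) content B h.
have I_dir (s : seq K) : [set` s] `<=` I -> exists2 h, JX h & [set` s] `<=` content B h.
  elim: s => [_|x s IHs sI]; first by exists 0.
  have [|h Jh sh] := IHs; first by move=> y sy; apply: sI; rewrite /= inE [y \in s]sy orbT.
  have [|k Jk kx] := sI x; first by rewrite /= mem_head.
  exists (h + 'X^(size h) * k); first exact: JX_shift.
  move=> y; rewrite /= inE => /predU1P[->|sy]; first exact: content_shift_addr kx.
  by apply: content_shift_addl => //; apply: sh.
have idI : ideal B I.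
  split=> [x [h [Bh _]]|]; first by apply: (content_subP _ HB).2.
  split=> [|x y Ix Iy|a x Ba [h Jh hx]].
  - by exists 0 => //; case: (@span_submodule _ B [set` (0 : {poly K}) : seq K]).
  - have [|h Jh xyh] := I_dir [:: x; y].
      by move=> z; rewrite /= !inE => /orP[]/eqP->.
    exists h => //; have [_ cD _] := @span_submodule _ B [set` h : seq K].
    by apply: cD; apply: xyh; rewrite /= !inE eqxx ?orbT.
  - by exists h => //; have [_ _ cM] := @span_submodule _ B [set` h : seq K]; apply: cM.
have nI1 : ~ star_f I 1.
  move=> [F [fgF FI] F1]; have [_ [t defF]] := fgF.
  have [|h Jh th] := I_dir t.
    by move=> x tx; apply: FI; rewrite defF; apply: sub_span.
  apply: (JX_notprim h Jh); split; first by case: Jh.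
  exists F => //; split=> //; rewrite defF; apply: span_sub => //.
  exact: span_submodule.
have [Q MQ IQ] : exists2 Q, Mstar_f star Q & I `<=` Q.
  (* When [I] is zero, so is [J], and any [Q] will do. *)
  have [FI|I0] := pselect (Fbar I); first exact: (Mstar_f_above star_semistar).
  have [Q MQ] := Mstar_f_nonempty star_semistar star_nontrivial; exists Q => //.
  move=> x Ix; have [-> |x0] := eqVneq x 0; first by case: (Mstar_f_ideal MQ) => _ [].
  by case: I0; apply: Fbar_of_neq0 idI.2 Ix x0.
exists Q => // r Jr; move: (JN r Jr) (Jr); rewrite {1}NaE => -[f [g [Bf pg ->]]] Jfg.
apply/(trace_mem MQ Bf pg); apply/(content_subP _ (Mstar_f_ideal MQ).2).
apply: subset_trans IQ => x fx; exists f => //; split=> //.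
have g0 : tofrac g != 0 by rewrite tofrac_eq0; apply: star_primitive_neq0.
rewrite -[tofrac f](mulfVK g0) mulrC; apply: JM => //; apply: Na_poly.
by case: pg.
Qed.

End NagataRing.

Theorem theorem3p8 (D : idomainType)
    (star : set {fraction D} -> set {fraction D})
    (star_semistar : semistar_operation star)
    (star_nontrivial : ~ trivial_semistar star) :
  Max (Na star) =
  [set extension_to_Nagata Q `&` Na star | Q in Mstar_f star].
Proof.
have above J := @proper_ideal_sub_trace D star star_semistar star_nontrivial J.
have trace_proper Q := @trace_proper_ideal D star star_semistar star_nontrivial Q.
rewrite eqEsubset; split=> [M [[idM neMN] Mmax]|_ [Q MQ <-]].
  have [Q MQ MPQ] := above M idM neMN.
  by exists Q => //; apply: Mmax => //; apply: trace_proper.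
split=> [|J [idJ neJN] QJ]; first exact: trace_proper.
have [Q' MQ' JQ'] := above J idJ neJN.
have QQ' : Q `<=` Q'.
  exact: (trace_sub star_semistar star_nontrivial) (subset_trans QJ JQ').
have defQ' : Q' = Q by apply: MQ.2 QQ'; apply: MQ'.1.
by rewrite eqEsubset; split=> //; rewrite -{1}defQ'.
Qed.
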